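(* Let $M^3$ be a translation hypersurface of type 4 in $\mathbb{I}^4$, i.e. $M^3$ is parameterized by $$r(u,v,w)=\left(f(u)+g(v)+h(w),\ u+v+6w,\ u+v-w,\ u-v+w+\tfrac{5\pi}{6}\right)$$ with $f,g,h$ smooth real functions of one variable and $f'(u)-g'(v)\neq0$, and suppose its isotropic mean curvature is a nonzero constant. Then, for some $\lambda,\mu,\xi\in\mathbb{R}$, one of the following occurs (up to translations of the parameters, additive constants, and interchanging the roles of $f$ and $g$): (i) $f(u)=\lambda u$, $g(v)=\mu v$, $h(w)=\xi w^2$, $\lambda\neq\mu$, $\xi\neq0$; (ii) $f(u)=\lambda u$, $g(v)=\lambda v+\mu v^{\frac12}$, $h(w)=\xi w$, $\mu\neq0$.
   Context: The isotropic space $\mathbb{I}^4$ is $\mathbb{R}^4$ with affine coordinates $(x_1,\dots,x_4)$ and the degenerate metric $dx_1^2+dx_2^2+dx_3^2$. All hypersurfaces considered have tangent hyperplanes not parallel to the $x_4$-axis. For a parameterized hypersurface $r$, let $[g_{ij}]$ be the matrix of the first fundamental form induced by the degenerate metric and $h_{ij}=\det(r_u,r_v,r_w,r_{ij})/\sqrt{\det g_{ij}}$, with $r_{ij}$ the second partial derivatives. The isotropic mean curvature $H$ is defined by $3H=\mathrm{tr}([h_{ij}][g_{ij}]^{-1})$. For a type 4 hypersurface (with the sign convention used here) $$3H=\frac{2}{49(f'-g')^3}\Big\{\left[37(g')^2+2(h')^2-10g'h'+49\right]f''+\left[37(f')^2+2(h')^2-10f'h'+49\right]g''+2h''(f'-g')^2\Big\}.$$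 ''Up to translations of the parameters and additive constants'' means that each of $f,g,h$ may be replaced by $\varphi(t+t_0)+c$ with $t_0,c\in\mathbb{R}$. In (ii), $v^{1/2}$ is real and understood up to reflection of the argument, i.e. as $(\varepsilon v)^{1/2}$ with $\varepsilon\in\{1,-1\}$. *)

(* Defs.v *)
From HB Require Import structures.
From mathcomp Require Import all_boot all_order all_algebra.
From mathcomp Require Import all_classical all_reals all_analysis.

Set Implicit Arguments.
Unset Strict Implicit.
Unset Printing Implicit Defensive.

Import Order.TTheory GRing.Theory Num.Theory.
Import numFieldNormedType.Exports.

Local Open Scope ring_scope.
Local Open Scope classical_set_scope.

Section IsotropicHypersurfaces.
Context {R : realType}.

Definition open_interval (A : set R) : Prop :=
  [/\ open A, is_interval A & A !=set0].

(* Since A is open below, the values of the iterated derivatives on A do not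
   depend on the values of f outside A. *)
Definition smooth_on (A : set R) (f : R -> R) : Prop :=
  forall (n : nat) (x : R), A x -> derivable (f^`(n)) x 1.

(* The degenerate metric dx_1^2 + dx_2^2 + dx_3^2 on R^4: coordinates are
   numbered from 0, so the isotropic direction x_4 is the index 3. *)
Definition iso_dot (x y : 'rV[R]_4) : R :=
  \sum_(k < 4 | (k < 3)%N) x 0 k * y 0 k.

(* The parameters (u, v, w) are the coordinates 0, 1, 2 of p : 'rV[R]_3. *)
Definition partial (i : 'I_3) (r : 'rV[R]_3 -> 'rV[R]_4) (p : 'rV[R]_3) :
  'rV[R]_4 := 'D_(delta_mx 0 i) r p.

Definition first_form (r : 'rV[R]_3 -> 'rV[R]_4) (p : 'rV[R]_3) : 'M[R]_3 :=
  \matrix_(i < 3, j < 3) iso_dot (partial i r p) (partial j r p).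

Definition tangent_frame (r : 'rV[R]_3 -> 'rV[R]_4) (p : 'rV[R]_3) :
  'M[R]_(3, 4) := \matrix_(i < 3) partial i r p.

(* h_ij = det (r_u, r_v, r_w, r_ij) / sqrt (det g), the vectors being the rows
   of the 4 x 4 matrix.  For type 4 below, sqrt (det g) = 7 |f' - g'|; the
   closed formula for H with (f' - g')^3 in the denominator thus differs by the
   sign of f' - g', which is constant on a product of intervals. *)
Definition second_form (r : 'rV[R]_3 -> 'rV[R]_4) (p : 'rV[R]_3) : 'M[R]_3 :=
  \matrix_(i < 3, j < 3)
    (\det (col_mx (tangent_frame r p) (partial j (partial i r) p) : 'M[R]_4)
     / Num.sqrt (\det (first_form r p))).

Definition iso_mean_curvature (r : 'rV[R]_3 -> 'rV[R]_4) (p : 'rV[R]_3) : R :=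
  \tr (second_form r p *m invmx (first_form r p)) / 3.

Definition box (I J K : set R) : set 'rV[R]_3 :=
  [set p | I (p 0 0) /\ J (p 0 1) /\ K (p 0 2)].

Definition type4 (f g h : R -> R) (p : 'rV[R]_3) : 'rV[R]_4 :=
  let u := p 0 0 in let v := p 0 1 in let w := p 0 2 in
  \row_(k < 4) [:: f u + g v + h w;
                   u + v + 6 * w;
                   u + v - w;
                   u - v + w + 5 * pi / 6]`_k.

(* On A, f is phi (t + t0) + c for some real t0 and c, where phi is a function
   with domain D. *)
Definition equiv_on (A : set R) (f : R -> R) (D : set R) (phi : R -> R) : Prop :=
  exists t0 c : R, forall t : R, A t -> D (t + t0) /\ f t = phi (t + t0) + c.

Definition family_i (lambda mu xi : R) (I J K : set R) (f g h : R -> R) : Prop :=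
  [/\ lambda != mu, xi != 0,
      equiv_on I f setT (fun u => lambda * u),
      equiv_on J g setT (fun v => mu * v)
    & equiv_on K h setT (fun w => xi * w ^+ 2)].

(* The square root is real, up to reflection of its argument; Num.sqrt is 0 on
   negative reals, hence the explicit domain of the model of g. *)
Definition family_ii (lambda mu xi : R) (I J K : set R) (f g h : R -> R) : Prop :=
  exists2 eps : R, eps = 1 \/ eps = -1 &
  [/\ mu != 0,
      equiv_on I f setT (fun u => lambda * u),
      equiv_on J g [set v | 0 < eps * v]
        (fun v => lambda * v + mu * Num.sqrt (eps * v))
    & equiv_on K h setT (fun w => xi * w)].

End IsotropicHypersurfaces.

(* Main.v *)
(* Write a = f', b = g', c = h' and k = 147 s H / 2, where s is the constant
   sign of a - b.  The curvature equation reads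
     W(b,c) f'' + W(a,c) g'' + 2 (a - b)^2 h'' = k (a - b)^3
   with W(x,c) = 37 x^2 + 2 c^2 - 10 x c + 49 > 0.  By the intermediate value
   theorem a nonconstant a, b or c takes values in arithmetic progression, so
   that finite differences in these values replace derivatives.
   If c is not constant, differences in c give f'' + g'' = m (a - b)^2 and
   b f'' + a g'' = n (a - b)^2 with constants m, n; hence f'' = g'' = 0, and h''
   is a nonzero constant: this is (i).  If c is constant and neither a nor b is,
   the third difference in a shows that W(b,c) is constant, which its second
   difference in b contradicts.  If finally c and, say, a = lambda are constant,
   then g'' = kappa (lambda - g')^3, which integrates to (ii). *)
Require Import Defs.
From HB Require Import structures.
From mathcomp Require Import all_boot all_order all_algebra.
From mathcomp Require Import all_classical all_reals all_analysis.
From mathcomp Require Import ring lra.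

Set Implicit Arguments.
Unset Strict Implicit.
Unset Printing Implicit Defensive.

Import Order.TTheory GRing.Theory Num.Theory.
Import numFieldNormedType.Exports.

Local Open Scope ring_scope.
Local Open Scope classical_set_scope.

(** * Calculus on intervals: intermediate values, primitives, constant signs *)

Section RealAnalysis.
Context {R : realType}.
Implicit Types (A : set R) (f g : R -> R).

Lemma ivt_on A f x y z : is_interval A ->
  (forall t, A t -> derivable f t 1) -> A x -> A y -> f x <= z <= f y ->
  exists2 t, A t & f t = z.
Proof.
move=> iA df Ax Ay xzy.
have mm : Num.min (f x) (f y) <= z <= Num.max (f x) (f y).
  by case/andP: xzy => xz zy; rewrite ge_min xz le_max zy orbT.
have cf a b : A a -> A b -> {within `[a, b], continuous f}.
  move=> Aa Ab; apply: derivable_within_continuous => t.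
  by rewrite in_itv/= => /(iA _ _ Aa Ab) /df.
have [xy|/ltW yx] := leP x y.
  have [t + <-] := IVT xy (cf _ _ Ax Ay) mm.
  by rewrite in_itv/= => /(iA _ _ Ax Ay) At; exists t.
rewrite minC maxC in mm.
have [t + <-] := IVT yx (cf _ _ Ay Ax) mm.
by rewrite in_itv/= => /(iA _ _ Ay Ax) At; exists t.
Qed.

(** Serves for every integration below: a primitive is guessed, and the mean value theorem applied
    to [f - g] leaves only a constant. *)
Lemma derive_eq_on A f g (d : R -> R) : is_interval A -> A !=set0 ->
  (forall t, A t -> is_derive t 1 f (d t)) ->
  (forall t, A t -> is_derive t 1 g (d t)) ->
  exists c : R, forall t, A t -> f t = g t + c.
Proof.
move=> iA [t0 At0] fd gd; exists (f t0 - g t0) => t At.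
suff : f t - g t = f t0 - g t0 by move=> <-; rewrite addrC subrK.
have D x : A x -> is_derive x 1 (f - g) 0.
  by move=> Ax; rewrite -(subrr (d x)); apply: is_deriveB; [exact: fd|
    exact: gd].
wlog tt0 : t t0 At At0 / t <= t0.
  by move=> W; have [/W|/ltW /W ->] := leP t t0; [apply|..].
have inA x : x \in `[t, t0]%R -> A x by rewrite in_itv/=; exact: iA.
have [x xt||x _] := @MVT_segment _ (f - g) (cst 0) t t0 tt0.
- by apply/D/inA; apply: subset_itv_oo_cc xt.
- by apply: derivable_within_continuous => x /inA /D [].
- by rewrite mul0r => /eqP; rewrite subr_eq0 => /eqP /esym.
Qed.

Lemma derive1_cst_on A f (c : R) x : open A -> A x ->
  (forall t, A t -> f t = c) -> derive1 f x = 0.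
Proof.
move=> oA Ax fc; rewrite derive1E -(derive_cst c x 1).
apply: near_eq_derive; near=> t; apply: fc; near: t.
exact: open_nbhs_nbhs.
Unshelve. all: by end_near. Qed.

(** Four equally spaced values are what a third difference needs. The values are equally spaced, not
    the points where they are taken. *)
Lemma progression_on A f : is_interval A ->
  (forall t, A t -> derivable f t 1) ->
  (forall x y, A x -> A y -> f x = f y) \/
  exists c d : R, d != 0 /\
    forall n, (n <= 3)%N -> exists2 t, A t & f t = c + n%:R * d.
Proof.
move=> iA df; have [|ncst] := pselect (forall x y, A x -> A y -> f x = f y).
  by left.
right; have [x [y [Ax Ay fxy]]] : exists x y, [/\ A x, A y & f x < f y].
  apply: contrapT => H; apply: ncst => x y Ax Ay; apply/eqP/contraT.
  rewrite neq_lt => /orP[xy|yx]; exfalso; apply: H.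
    by exists x, y.
  by exists y, x.
(* With this step the progression runs from [f x] to [f y], so the intermediate value theorem
   reaches each term. *)
exists (f x), ((f y - f x) / 3); split => [|n n3].
  by rewrite mulf_neq0// subr_eq0 gt_eqF.
apply: (ivt_on iA df Ax Ay).
have n0 : 0 <= n%:R :> R by [].
have {}n3 : n%:R <= 3 :> R by rewrite (ler_nat _ n 3).
by apply/andP; split; nra.
Qed.

(** Move one variable at a time, from [u0] to [u] and then from [v0] to [v]: a change of order would
    force a common value of [f] and [g]. *)
Lemma gt_on I J f g u0 v0 : is_interval I -> is_interval J ->
  (forall t, I t -> derivable f t 1) -> (forall t, J t -> derivable g t 1) ->
  (forall u v, I u -> J v -> f u != g v) -> I u0 -> J v0 -> g v0 < f u0 ->
  forall u v, I u -> J v -> g v < f u.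
Proof.
move=> iI iJ df dg fg Iu0 Jv0 gf0 u v Iu Jv.
have gfu : g v0 < f u.
  rewrite ltNge; apply/negP => uv0.
  have [|t It /eqP] := ivt_on (z := g v0) iI df Iu Iu0.
    by rewrite uv0 ltW.
  exact/negP/fg.
rewrite ltNge; apply/negP => uv.
have [|t Jt /esym/eqP] := ivt_on (z := f u) iJ dg Jv0 Jv.
  by rewrite uv ltW.
exact/negP/fg.
Qed.

(** Applied to [f'] and [g'], it replaces the absolute value coming from the square root of the
    determinant by a constant sign. *)
Lemma sign_on I J f g :
  is_interval I -> is_interval J -> I !=set0 -> J !=set0 ->
  (forall t, I t -> derivable f t 1) -> (forall t, J t -> derivable g t 1) ->
  (forall u v, I u -> J v -> f u != g v) ->
  exists2 s : R, s ^+ 2 = 1 &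
    forall u v, I u -> J v -> `|f u - g v| = s * (f u - g v).
Proof.
move=> iI iJ [u0 Iu0] [v0 Jv0] df dg fg.
have := fg _ _ Iu0 Jv0; rewrite neq_lt => /orP[fg0|gf0].
  exists (-1) => [|u v Iu Jv]; first by rewrite sqrrN expr1n.
  rewrite mulN1r ltr0_norm// subr_lt0.
  apply: (gt_on iJ iI dg df _ Jv0 Iu0 fg0) => // x y Jx Iy.
  by rewrite eq_sym fg.
exists 1 => [|u v Iu Jv]; first by rewrite expr1n.
rewrite mul1r gtr0_norm// subr_gt0.
exact: (gt_on iI iJ df dg fg Iu0 Jv0 gf0).
Qed.

End RealAnalysis.

(** * Algebra of the curvature equation at a point *)

Section Classification.
Context {R : realType}.
Implicit Types (I J K : set R) (f g h : R -> R) (a b c k lambda : R).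

(* [weight b c] and [weight a c] are the first two diagonal cofactors of the
   first fundamental form. *)
Definition weight (x c : R) : R := 37 * x ^+ 2 + 2 * c ^+ 2 - 10 * x * c + 49.

Lemma weight_gt0 x c : 0 < weight x c.
Proof.
have -> : weight x c = (5 * x - c) ^+ 2 + 12 * x ^+ 2 + c ^+ 2 + 49.
  by rewrite /weight; ring.
by rewrite ltr_wpDl// !addr_ge0 ?sqr_ge0// mulr_ge0 ?sqr_ge0.
Qed.

(** First derivatives [a b c] and second derivatives [A B C] are independent reals here, so that the
    eliminations are pure algebra. *)
Definition curvature_rel k a b c A B C : Prop :=
  weight b c * A + weight a c * B + 2 * (a - b) ^+ 2 * C = k * (a - b) ^+ 3.

Lemma curvature_rel_swap k a b c A B C :
  curvature_rel k a b c A B C -> curvature_rel (- k) b a c B A C.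
Proof. by rewrite /curvature_rel; lra. Qed.

(** The coefficient of [X] is quadratic in the first slope, so a third difference kills it, while
    the cubic right-hand side leaves [6 * k * d ^+ 3]. *)
Lemma curvature_rel_third_difference k a d b c X A0 A1 A2 A3 :
  curvature_rel k (a + 0 * d) b c A0 X 0 ->
  curvature_rel k (a + 1 * d) b c A1 X 0 ->
  curvature_rel k (a + 2 * d) b c A2 X 0 ->
  curvature_rel k (a + 3 * d) b c A3 X 0 ->
  weight b c * (A3 - 3 * A2 + 3 * A1 - A0) = 6 * k * d ^+ 3.
Proof. by rewrite /curvature_rel /weight => E0 E1 E2 E3; lra. Qed.

Lemma weight_second_difference b e c y :
  weight (b + 0 * e) c = y -> weight (b + 1 * e) c = y ->
  weight (b + 2 * e) c = y -> e = 0.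
Proof.
rewrite /weight => E0 E1 E2; have : 74 * e ^+ 2 = 0 by lra.
by move/eqP; rewrite mulf_eq0 expf_eq0/= pnatr_eq0/= => /eqP.
Qed.

(** Only [c] and [C] vary. The second difference in [c] isolates [A + B], then the first one
    isolates [b * A + a * B]; these two combinations determine [A]. As [m] and [n] involve only [c],
    [d] and the [C]s, they will not depend on [u] and [v]. *)
Lemma curvature_rel_difference_c k a b A B c d C0 C1 C2 :
  d != 0 -> a - b != 0 ->
  let E n C := curvature_rel k a b (c + n * d) A B C in
  let m := - (C2 - 2 * C1 + C0) / (2 * d ^+ 2) in
  let n := (C1 - C0 + (2 * c * d + d ^+ 2) * m) / (5 * d) in
  E 0 C0 -> E 1 C1 -> E 2 C2 ->
  A + B = m * (a - b) ^+ 2 /\ A = (a * m - n) * (a - b).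
Proof.
move=> d0 ab0 E m n; rewrite /E /curvature_rel /weight => E0 E1 E2.
have AB : A + B = m * (a - b) ^+ 2.
  have H : 2 * d ^+ 2 != 0 by rewrite mulf_neq0// expf_neq0.
  have mE : 2 * d ^+ 2 * m = - (C2 - 2 * C1 + C0) by rewrite mulrC divfK.
  by apply: (mulfI H); rewrite [RHS]mulrA mE; lra.
have bAaB : b * A + a * B = n * (a - b) ^+ 2.
  have H : 5 * d != 0 by rewrite mulf_neq0.
  have nE : 5 * d * n = C1 - C0 + (2 * c * d + d ^+ 2) * m.
    by rewrite mulrC divfK.
  by apply: (mulfI H); rewrite [RHS]mulrA nE [RHS]mulrDl -(mulrA _ m) -AB; lra.
split=> //; apply: (mulIf ab0).
transitivity (a * (A + B) - (b * A + a * B)); first by ring.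
by rewrite AB bAaB; ring.
Qed.

(** * The curvature equation on a product of intervals: constant derivatives and integration *)

Definition curvature_eq (k : R) I J K f g h := forall u v w,
  I u -> J v -> K w ->
  curvature_rel k (derive1 f u) (derive1 g v) (derive1 h w)
    (derive1 (derive1 f) u) (derive1 (derive1 g) v) (derive1 (derive1 h) w).

Lemma curvature_eq_swap k I J K f g h : curvature_eq k I J K f g h ->
  curvature_eq (- k) J I K g f h.
Proof. by move=> E v u w Jv Iu Kw; apply/curvature_rel_swap/E. Qed.

Lemma not_both_nonconstant k I J K f g h w :
  k != 0 -> is_interval I -> is_interval J ->
  smooth_on I f -> smooth_on J g -> K w ->
  curvature_eq k I J K f g h -> derive1 (derive1 h) w = 0 ->
  (forall x y, I x -> I y -> derive1 f x = derive1 f y) \/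
  (forall x y, J x -> J y -> derive1 g x = derive1 g y).
Proof.
move=> k0 iI iJ sf sg Kw E hw.
have [|[a [d [d0 Ha]]]] := @progression_on _ _ (derive1 f) iI (sf 1%N).
  by left.
have [|[b [e [e0 Hb]]]] := @progression_on _ _ (derive1 g) iJ (sg 1%N).
  by right.
exfalso; set c := derive1 h w.
have [u0 Iu0 au0] := Ha 0%N isT; have [u1 Iu1 au1] := Ha 1%N isT.
have [u2 Iu2 au2] := Ha 2%N isT; have [u3 Iu3 au3] := Ha 3%N isT.
have [v0 Jv0 bv0] := Hb 0%N isT; have [v1 Jv1 bv1] := Hb 1%N isT.
have [v2 Jv2 bv2] := Hb 2%N isT.
(* [X] does not depend on [v], so [WX] makes the weight of [g'] constant once [X] is known to be
   nonzero. *)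
pose X := derive1 (derive1 f) u3 - 3 * derive1 (derive1 f) u2
          + 3 * derive1 (derive1 f) u1 - derive1 (derive1 f) u0.
have WX v : J v -> weight (derive1 g v) c * X = 6 * k * d ^+ 3.
  move=> Jv.
  apply: (@curvature_rel_third_difference k a d _ _ (derive1 (derive1 g) v)).
  - by rewrite -au0 -hw; exact: E.
  - by rewrite -au1 -hw; exact: E.
  - by rewrite -au2 -hw; exact: E.
  - by rewrite -au3 -hw; exact: E.
have X0 : X != 0.
  apply: contra_eq_neq (WX _ Jv0) => ->; rewrite mulr0 eq_sym.
  by rewrite !mulf_neq0// expf_neq0.
have W v : J v -> weight (derive1 g v) c = 6 * k * d ^+ 3 / X.
  by move=> /WX <-; rewrite mulfK.
apply/negP: e0; apply/negPn/eqP.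
apply: (@weight_second_difference b e c (6 * k * d ^+ 3 / X)).
- by rewrite -bv0 W.
- by rewrite -bv1 W.
- by rewrite -bv2 W.
Qed.

(** Division by [(a - b) ^+ 2] leaves an equation linear in [a], whose solution depends only on [b],
    [c] and [C]. *)
Lemma curvature_rel_solve k m a b c C : k != 0 -> a - b != 0 ->
  curvature_rel k a b c (m * (a - b) ^+ 2) 0 C ->
  a = b + (weight b c * m + 2 * C) / k.
Proof.
move=> k0 ab0 E; apply/eqP; rewrite addrC -subr_eq; apply/eqP.
have ab2 : (a - b) ^+ 2 != 0 by rewrite expf_neq0.
apply: (mulIf k0); rewrite divfK//; apply: (mulIf ab2).
by move: E; rewrite /curvature_rel; move: (weight b c) (weight a c) => x y; lra.
Qed.

(** [A] is the same for two distinct values of [b], so the factor [x] must vanish. *)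
Lemma vanishing_slope (x a b e A : R) : e != 0 ->
  A = x * (a - (b + 0 * e)) -> A = x * (a - (b + 1 * e)) -> A = 0.
Proof.
move=> e0 A0 A1; have /eqP : x * e = 0 by lra.
by rewrite mulf_eq0 (negbTE e0) orbF A0 => /eqP ->; rewrite mul0r.
Qed.

Lemma f_linear_of_nonlinear_h k I J K f g h :
  k != 0 -> open I -> open J -> is_interval J -> is_interval K ->
  smooth_on I f -> smooth_on J g -> smooth_on K h -> J !=set0 ->
  (forall u v, I u -> J v -> derive1 f u - derive1 g v != 0) ->
  curvature_eq k I J K f g h ->
  ~ (forall x y, K x -> K y -> derive1 h x = derive1 h y) ->
  forall u, I u -> derive1 (derive1 f) u = 0.
Proof.
move=> k0 oI oJ iJ iK sf sg sh [v0 Jv0] fg E hncst.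
have [//|[c [d [d0 Hc]]]] := @progression_on _ _ (derive1 h) iK (sh 1%N).
have [w0 Kw0 cw0] := Hc 0%N isT; have [w1 Kw1 cw1] := Hc 1%N isT.
have [w2 Kw2 cw2] := Hc 2%N isT.
pose C w := derive1 (derive1 h) w.
pose m := - (C w2 - 2 * C w1 + C w0) / (2 * d ^+ 2).
pose n := (C w1 - C w0 + (2 * c * d + d ^+ 2) * m) / (5 * d).
have fE u v : I u -> J v ->
    derive1 (derive1 f) u + derive1 (derive1 g) v
      = m * (derive1 f u - derive1 g v) ^+ 2 /\
    derive1 (derive1 f) u = (derive1 f u * m - n) * (derive1 f u - derive1 g v).
  move=> Iu Jv; apply: (@curvature_rel_difference_c k) => //.
  - exact: fg.
  - by rewrite -cw0; exact: E.
  - by rewrite -cw1; exact: E.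
  - by rewrite -cw2; exact: E.
(* If [g'] takes two values, the formula for [f''] forces [f'' = 0] at once. Otherwise [g'' = 0], so
   [f'' = m (f' - g')^2], and solving the curvature equation for [f'] shows it constant. *)
have [gcst|[b [e [e0 Hb]]]] :=
  @progression_on _ _ (derive1 g) iJ (sg 1%N); last first.
  have [v1 Jv1 bv1] := Hb 0%N isT; have [v2 Jv2 bv2] := Hb 1%N isT.
  move=> u Iu.
  apply: (@vanishing_slope (derive1 f u * m - n) (derive1 f u) b e) => //.
  - by rewrite -bv1; exact: (fE _ _ Iu Jv1).2.
  - by rewrite -bv2; exact: (fE _ _ Iu Jv2).2.
have B0 : derive1 (derive1 g) v0 = 0.
  by apply: (derive1_cst_on (c := derive1 g v0) oJ Jv0) => t Jt; exact: gcst.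
(* This value involves only the fixed points [v0] and [w0], so it is the constant value of [f']. *)
pose a0 :=
  derive1 g v0 + (weight (derive1 g v0) (derive1 h w0) * m + 2 * C w0) / k.
move=> u Iu; apply: (derive1_cst_on (c := a0) oI Iu) => t It.
apply: (@curvature_rel_solve k m _ _ _ (C w0)) => //; first exact: fg It Jv0.
by rewrite -(fE _ _ It Jv0).1 B0 addr0 -B0; exact: E.
Qed.

(* The function [y = 1 / (lambda - g')] satisfies [(y ^ 2)' = 2 kappa], and
   [g - lambda v] differs from [- y / kappa] by a constant, so no square root
   has to be differentiated. *)
Lemma cubic_ode J g (kappa lambda s : R) : is_interval J -> J !=set0 ->
  smooth_on J g -> kappa != 0 -> s ^+ 2 = 1 ->
  (forall v, J v -> lambda - derive1 g v != 0) ->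
  (forall v, J v -> `|lambda - derive1 g v| = s * (lambda - derive1 g v)) ->
  (forall v, J v ->
    derive1 (derive1 g) v = kappa * (lambda - derive1 g v) ^+ 3) ->
  exists eps mu : R, [/\ eps = 1 \/ eps = -1, mu != 0 &
    equiv_on J g [set v | 0 < eps * v]
      (fun v => lambda * v + mu * Num.sqrt (eps * v))].
Proof.
move=> iJ J0 sg k0 s2 b0 bs bE.
pose b v := lambda - derive1 g v; pose y v := (b v)^-1.
have gD v : J v -> is_derive v 1 g (derive1 g v).
  by move=> Jv; rewrite derive1E; apply: derivableP; exact: (sg 0%N).
have bD v : J v -> is_derive v 1 b (- (kappa * b v ^+ 3)).
  move=> Jv; rewrite -bE// -[X in is_derive _ _ _ X]sub0r; apply: is_deriveB.
  by rewrite derive1E; apply: derivableP; exact: (sg 1%N).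
have yD v : J v -> is_derive v 1 y (kappa * b v).
  move=> Jv; rewrite /y.
  apply: (is_derive_eq (is_deriveV (f := b) (b0 _ Jv) (bD _ Jv))).
  rewrite -[_ *: _]/(_ * _); move: (b0 _ Jv); rewrite -/(b v).
  by move: (b v) => x x0; field.
have [c1 y2E] : exists c1 : R, forall v, J v -> y v * y v = 2 * kappa * v + c1.
  apply: (derive_eq_on (d := fun _ => 2 * kappa) iJ J0) => v Jv.
    apply: is_derive_eq (is_deriveM (yD v Jv) (yD v Jv)) _.
    rewrite -[_ *: _]/(_ * _) -mulrDr /y; move: (b0 _ Jv); rewrite -/(b v).
    by move: (b v) => x x0; field.
  apply: is_derive_eq (is_deriveZ (2 * kappa) (is_derive_id v 1)) _.
  by rewrite -[_ *: _]/(_ * _) mulr1.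
have [c2 gE] : exists c2 : R, forall v, J v ->
    g v = (lambda * v - kappa^-1 * y v) + c2.
  apply: (derive_eq_on (d := derive1 g) iJ J0 gD) => v Jv.
  apply: is_derive_eq (is_deriveB (is_deriveZ lambda (is_derive_id v 1))
                                  (is_deriveZ kappa^-1 (yD v Jv))) _.
  rewrite -[kappa^-1 *: _]/(_ * _) mulKf// -[_ *: _]/(_ * _) mulr1 /b.
  by rewrite opprB addrC subrK.
have s0 : s != 0.
  by apply: contra_eq_neq s2 => ->; rewrite expr0n eq_sym oner_eq0.
(* [y] has the sign [s] of its inverse; this fixes the branch of the square root of [y ^ 2]. *)
have yn v : J v -> y v = s * `|y v|.
  move=> Jv; rewrite /y normfV bs// invfM mulrA.
  by rewrite divff// mul1r.
pose tau := 2 * kappa; have tau0 : tau != 0 by rewrite mulf_neq0.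
pose eps := Num.sg tau; pose r := Num.sqrt `|tau|.
have r0 : 0 < r by rewrite sqrtr_gt0 normr_gt0.
(* Since [y ^ 2 = tau * v + c1 = |tau| * (eps * (v + c1 / tau))], one has
   [y = s * r * sqrt (eps * (v + c1 / tau))]; then [mu] is read off
   [g = lambda * v - y / kappa + c2]. *)
exists eps, (- (kappa^-1 * s * r)); split.
- rewrite /eps; case: sgrP => [t0|_|_]; [|by left|by right].
  by move: tau0; rewrite t0 eqxx.
- by rewrite oppr_eq0 !mulf_neq0 ?invr_neq0// gt_eqF.
(* The constant also absorbs the shift of the argument in the term [lambda * v]. *)
exists (c1 / tau), (c2 - lambda * (c1 / tau)) => v Jv.
have y2 : y v * y v = `|tau| * (eps * (v + c1 / tau)).
  rewrite y2E// mulrA (mulrC `|tau|) -numEsg mulrDr (mulrC tau (_ / _)).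
  by rewrite divfK.
have pos : 0 < eps * (v + c1 / tau).
  rewrite -(pmulr_rgt0 _ (_ : 0 < `|tau|)) ?normr_gt0// -y2 -expr2.
  by rewrite exprn_even_gt0//= invr_neq0// b0.
split=> //; rewrite gE// yn// -(sqrtr_sqr (y v)) expr2 y2 sqrtrM ?normr_ge0//.
rewrite -/r; set q := Num.sqrt _; set t := c1 / tau; set z := kappa^-1.
by clearbody q t z r; clear; ring.
Qed.

Lemma affine_on J g (lambda : R) : is_interval J -> J !=set0 -> smooth_on J g ->
  (forall v, J v -> derive1 g v = lambda) ->
  equiv_on J g setT (fun v => lambda * v).
Proof.
move=> iJ J0 sg gl.
have [c gE] : exists c : R, forall v, J v -> g v = lambda * v + c.
  apply: (derive_eq_on (d := fun=> lambda) iJ J0) => v Jv.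
    by rewrite -(gl v Jv) derive1E; apply: derivableP; exact: (sg 0%N).
  apply: is_derive_eq (is_deriveZ lambda (is_derive_id v 1)) _.
  by rewrite -[_ *: _]/(_ * _) mulr1.
by exists 0, c => v Jv; split=> //; rewrite gE// addr0.
Qed.

Lemma derive1_affine_on J g (lambda : R) : is_interval J -> J !=set0 ->
  smooth_on J g -> (forall v, J v -> derive1 (derive1 g) v = lambda) ->
  exists c : R, forall v, J v -> derive1 g v = lambda * v + c.
Proof.
move=> iJ J0 sg gl; apply: (derive_eq_on (d := fun=> lambda) iJ J0) => v Jv.
  by rewrite -(gl v Jv) derive1E; apply: derivableP; exact: (sg 1%N).
apply: is_derive_eq (is_deriveZ lambda (is_derive_id v 1)) _.
by rewrite -[_ *: _]/(_ * _) mulr1.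
Qed.

Lemma quadratic_on K h (xi : R) : is_interval K -> K !=set0 ->
  smooth_on K h -> xi != 0 ->
  (forall w, K w -> derive1 (derive1 h) w = 2 * xi) ->
  equiv_on K h setT (fun w => xi * w ^+ 2).
Proof.
move=> iK K0 sh xi0 hxi; have [c hE] := derive1_affine_on iK K0 sh hxi.
(* Completing the square: [2 * xi * w + c = 2 * xi * (w + t0)]. *)
pose t0 := c / (2 * xi).
have [d hd] : exists d : R, forall w, K w ->
    h w = xi * ((w + t0) * (w + t0)) + d.
  apply: (derive_eq_on (d := fun w => 2 * xi * w + c) iK K0) => w Kw.
    by rewrite -hE// derive1E; apply: derivableP; exact: (sh 0%N).
  have D := is_deriveD (is_derive_id w (1 : R)) (is_derive_cst t0 w (1 : R)).
  apply: is_derive_eq (is_deriveZ xi (is_deriveM D D)) _.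
  transitivity (xi * ((w + t0) * (1 + 0) + (w + t0) * (1 + 0))); first by [].
  have -> : c = 2 * xi * t0 by rewrite mulrC divfK// mulf_neq0.
  by ring.
by exists t0, d => w Kw; split=> //; rewrite hd// expr2.
Qed.

(** * The two families of solutions *)

Lemma classification_linear_h k (s : R) I J K f g h :
  k != 0 -> s ^+ 2 = 1 ->
  open_interval I -> open_interval J -> open_interval K ->
  smooth_on I f -> smooth_on J g -> smooth_on K h ->
  (forall u v, I u -> J v -> derive1 f u - derive1 g v != 0) ->
  (forall u v, I u -> J v ->
    `|derive1 f u - derive1 g v| = s * (derive1 f u - derive1 g v)) ->
  curvature_eq k I J K f g h ->
  (forall x y, K x -> K y -> derive1 h x = derive1 h y) ->
  (forall x y, I x -> I y -> derive1 f x = derive1 f y) ->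
  exists lambda mu xi : R, family_ii lambda mu xi I J K f g h.
Proof.
move=> k0 s2 [oI iI I0] [oJ iJ J0] [oK iK K0] sf sg sh fg fgs E hc fc.
have [u Iu] := I0; have [w Kw] := K0.
pose lambda := derive1 f u; pose xi := derive1 h w.
have A0 : derive1 (derive1 f) u = 0.
  by apply: (derive1_cst_on (c := lambda) oI Iu) => t It; exact: fc.
have C0 : derive1 (derive1 h) w = 0.
  by apply: (derive1_cst_on (c := xi) oK Kw) => t Kt; exact: hc.
pose W := weight lambda xi; have W0 : W != 0 by rewrite gt_eqF// weight_gt0.
(* With [f'' = h'' = 0] the equation reads [W g'' = k (lambda - g')^3], whence [kappa = k / W]. *)
have [|||||eps [mu [eps1 mu0 gE]]] := @cubic_ode J g (k / W) lambda s iJ J0 sg.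
- by rewrite mulf_neq0// invr_neq0.
- exact: s2.
- by move=> v Jv; exact: fg.
- by move=> v Jv; exact: fgs.
- move=> v Jv; apply: (mulfI W0); rewrite mulrA [W * (k / W)]mulrC divfK//.
  have := E _ _ _ Iu Jv Kw; rewrite A0 C0 /curvature_rel.
  by rewrite !mulr0 add0r addr0.
exists lambda, mu, xi; exists eps => //; split => //.
- by apply: affine_on => // t It; exact: fc.
- by apply: affine_on => // t Kt; exact: hc.
Qed.

(** The factor 2 is kept apart to match the hypothesis of [quadratic_on] with
    [xi = k * (a - b) / 4]. *)
Lemma curvature_rel_solve_C k a b c C : a - b != 0 ->
  curvature_rel k a b c 0 0 C -> C = 2 * (k * (a - b) / 4).
Proof.
move=> ab0; rewrite /curvature_rel !mulr0 !add0r => E.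
have ab2 : (a - b) ^+ 2 != 0 by rewrite expf_neq0.
by apply: (mulIf ab2); lra.
Qed.

Lemma classification_nonlinear_h k I J K f g h :
  k != 0 -> open_interval I -> open_interval J -> open_interval K ->
  smooth_on I f -> smooth_on J g -> smooth_on K h ->
  (forall u v, I u -> J v -> derive1 f u - derive1 g v != 0) ->
  curvature_eq k I J K f g h ->
  ~ (forall x y, K x -> K y -> derive1 h x = derive1 h y) ->
  exists lambda mu xi : R, family_i lambda mu xi I J K f g h.
Proof.
move=> k0 [oI iI I0] [oJ iJ J0] [oK iK K0] sf sg sh fg E hn.
have A0 := f_linear_of_nonlinear_h k0 oI oJ iJ iK sf sg sh J0 fg E hn.
(* The same lemma with [f] and [g] interchanged, which turns [k] into [- k]. *)
have B0 : forall v, J v -> derive1 (derive1 g) v = 0.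
  apply: (f_linear_of_nonlinear_h _ oJ oI iI iK sg sf sh I0 _
    (curvature_eq_swap E) hn).
    by rewrite oppr_eq0.
  by move=> v u Jv Iu; rewrite -oppr_eq0 opprB fg.
have [u Iu] := I0; have [v Jv] := J0.
have [la fa] := derive1_affine_on iI I0 sf A0.
have [mu ga] := derive1_affine_on iJ J0 sg B0.
pose a := derive1 f u; pose b := derive1 g v.
exists a, b, (k * (a - b) / 4).
have xi0 : k * (a - b) / 4 != 0 by rewrite !mulf_neq0 ?invr_neq0// fg.
split=> //.
- by rewrite -subr_eq0 fg.
- by apply: affine_on => // t It; rewrite /a !fa// !mul0r.
- by apply: affine_on => // t Jt; rewrite /b !ga// !mul0r.
- apply: quadratic_on => // w Kw; apply: curvature_rel_solve_C; first exact: fg.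
  by rewrite -{1}(A0 _ Iu) -(B0 _ Jv); exact: E.
Qed.

(** As [s ^+ 2 = 1], the cube of [s * (a - b)] is [s * (a - b) ^+ 3], and [k] absorbs the remaining
    sign. *)
Lemma curvature_rel_of_mean k s H a b c A B C : s ^+ 2 = 1 -> a - b != 0 ->
  147 * (s * (a - b)) ^+ 3 * H =
    2 * (weight b c * A + weight a c * B + 2 * (a - b) ^+ 2 * C) ->
  k = 147 * s * H / 2 -> curvature_rel k a b c A B C.
Proof.
move=> s2 ab0 E ->; rewrite /curvature_rel.
move: E; rewrite exprMn (exprS s 2) s2 mulr1.
by move: (weight b c) (weight a c) => x y E; lra.
Qed.

End Classification.

(** * Fundamental forms and mean curvature of a type 4 hypersurface *)

Section Geometry.
Context {R : realType}.
Implicit Types (f g h : R -> R) (p : 'rV[R]_3) (a b c : R).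

(** The difference quotient of the composite along [v] is literally that of [phi] along the number
    [v 0 i]. *)
Lemma is_derive_coord n (phi : R -> R) (p v : 'rV[R]_n) (i : 'I_n) (d : R) :
  is_derive (p 0 i) (v 0 i) phi d ->
  is_derive p v (fun q : 'rV[R]_n => phi (q 0 i)) d.
Proof.
have E : (fun t : R => t^-1 *: (((fun q : 'rV[R]_n => phi (q 0 i)) \o shift p)
                          (t *: v) - phi (p 0 i)))
   = (fun t : R => t^-1 *: ((phi \o shift (p 0 i)) (t *: v 0 i) - phi (p 0 i))).
  by apply/funext => t /=; rewrite !mxE.
by case=> dphi dE; split; [rewrite /derivable E | rewrite -dE /derive E].
Qed.

Lemma is_derive_delta (phi : R -> R) p (i j : 'I_3) :
  derivable phi (p 0 j) 1 ->
  is_derive p (delta_mx 0 i) (fun q : 'rV[R]_3 => phi (q 0 j))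
    ((i == j)%:R * derive1 phi (p 0 j)).
Proof.
move=> dphi; apply: is_derive_coord; rewrite mxE eqxx eq_sym /=.
case: eqP => _; rewrite ?mul1r ?mul0r; last exact: is_derive0.
by rewrite derive1E; exact: derivableP.
Qed.

Lemma is_derive_row m n (G : 'rV[R]_m -> 'rV[R]_n) (x v : 'rV[R]_m)
    (dG : 'I_n -> R) :
  (forall k, is_derive x v (fun q : 'rV[R]_m => G q 0 k) (dG k)) ->
  is_derive x v G (\row_k dG k).
Proof.
move=> GdG; have dG' : derivable G x v.
  by apply/derivable_mxP => i k; rewrite (ord1 i); case: (GdG k).
split=> //; rewrite derive_mx//; apply/rowP => k; rewrite !mxE.
by case: (GdG k).
Qed.

Lemma ord3P (i : 'I_3) : [\/ i = 0, i = 1 | i = 2].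
Proof.
by case: i => [[|[|[|//]]] ?]; [apply: Or31|apply: Or32|apply: Or33];
  exact: val_inj.
Qed.

Definition pick3 (f g h : R -> R) (i : 'I_3) : R -> R :=
  match val i with 0%N => f | 1%N => g | _ => h end.

(** Only the first entry varies with the point; the others are the coefficients of the [i]-th
    parameter in the three affine coordinates. *)
Definition tangent_coords a (i : 'I_3) : seq R :=
  [:: a; [:: 1; 1; 6]`_i; [:: 1; 1; -1]`_i; [:: 1; -1; 1]`_i].

Lemma partial_type4 f g h p (i : 'I_3) :
  derivable f (p 0 0) 1 -> derivable g (p 0 1) 1 -> derivable h (p 0 2) 1 ->
  partial i (type4 f g h) p =
    \row_k (tangent_coords (derive1 (pick3 f g h i) (p 0 i)) i)`_k.
Proof.
move=> df dg dh.
have Df := is_derive_delta i df.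
have Dg := is_derive_delta i dg.
have Dh := is_derive_delta i dh.
have D0 := @is_derive_delta id p i 0 (@derivable_id _ _ _ _).
have D1 := @is_derive_delta id p i 1 (@derivable_id _ _ _ _).
have D2 := @is_derive_delta id p i 2 (@derivable_id _ _ _ _).
rewrite !derive1E !derive_id in D0 D1 D2.
rewrite /partial.
suff DT : is_derive p (delta_mx 0 i) (type4 f g h)
    (\row_k (tangent_coords (derive1 (pick3 f g h i) (p 0 i)) i)`_k).
  exact: derive_val.
apply: is_derive_row => k.
under eq_fun do rewrite mxE.
case: k => [[|[|[|[|//]]]] ?] /=.
- apply: (is_derive_eq (is_deriveD (is_deriveD Df Dg) Dh)).
  by case: (ord3P i) => -> /=; rewrite /pick3/= ?mul1r ?mul0r ?addr0 ?add0r.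
- apply: (is_derive_eq (is_deriveD (is_deriveD D0 D1) (is_deriveZ 6 D2))).
  by rewrite -[6 *: _]/(6 * _); case: (ord3P i) => -> /=; ring.
- apply: (is_derive_eq (is_deriveB (is_deriveD D0 D1) D2)).
  by case: (ord3P i) => -> /=; ring.
- apply: (is_derive_eq (is_deriveD (is_deriveD (is_deriveB D0 D1) D2)
                                   (is_derive_cst (5 * pi / 6) _ _))).
  by case: (ord3P i) => -> /=; ring.
Qed.

(** The only nonlinear coordinate is a sum of functions of one variable each, so mixed second
    partials vanish and the others lie along the first axis. *)
Lemma partial2_type4 (I J K : set R) f g h p (i j : 'I_3) :
  open I -> open J -> open K ->
  smooth_on I f -> smooth_on J g -> smooth_on K h -> box I J K p ->
  partial j (partial i (type4 f g h)) p =
    ((i == j)%:R * derive1 (derive1 (pick3 f g h i)) (p 0 i)) *: delta_mx 0 0.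
Proof.
move=> oI oJ oK sf sg sh bp.
pose F (q : 'rV[R]_3) : 'rV[R]_4 :=
  \row_k (tangent_coords (derive1 (pick3 f g h i) (q 0 i)) i)`_k.
(* The formula for the first partial is needed on a neighbourhood of [p] to be differentiated again;
   openness of the intervals provides it. *)
have E : \forall q \near p, F q = partial i (type4 f g h) q.
  have cp (k : 'I_3) (A : set R) : open A -> A (p 0 k) ->
      \forall q \near p, A ((q : 'rV[R]_3) 0 k).
    move=> oA Ap; have /coord_continuous := open_nbhs_nbhs (conj oA Ap).
    exact.
  have [Ip [Jp Kp]] := bp.
  near=> q; rewrite partial_type4//.
  - by apply: (sf 0%N); near: q; exact: cp.
  - by apply: (sg 0%N); near: q; exact: cp.
  - by apply: (sh 0%N); near: q; exact: cp.
have d1 : derivable (derive1 (pick3 f g h i)) (p 0 i) 1.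
  have [Ip [Jp Kp]] := bp.
  by case: (ord3P i) => ->; [apply: (sf 1%N)|apply: (sg 1%N)|apply: (sh 1%N)].
rewrite {1}/partial -(near_eq_derive _ E).
set e := _ * _.
suff DT : is_derive p (delta_mx 0 j) F
    (\row_k [:: e; 0; 0; 0]`_k : 'rV[R]_4).
  rewrite derive_val; apply/rowP => k; rewrite !mxE.
  by case: k => [[|[|[|[|//]]]] ?] /=; rewrite ?mulr1 ?mulr0.
apply: is_derive_row => k; under eq_fun do rewrite mxE.
case: k => [[|[|[|[|//]]]] ?] /=; try exact: is_derive_cst.
by apply: is_derive_eq (is_derive_delta j d1) _; rewrite eq_sym.
Unshelve. all: by end_near. Qed.

Lemma det_mx33 (A : 'M[R]_3) :
  \det A = A 0 0 * (A 1 1 * A 2 2 - A 1 2 * A 2 1)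
         - A 0 1 * (A 1 0 * A 2 2 - A 1 2 * A 2 0)
         + A 0 2 * (A 1 0 * A 2 1 - A 1 1 * A 2 0).
Proof.
(* Indexing entries by natural numbers lets the different ordinals produced by the expansion compute
   to the same index before [ring]. *)
have [a aE] : exists a : nat -> nat -> R, forall i j, A i j = a i j.
  by exists (fun i j => A (inord i) (inord j)) => i j; rewrite !inord_val.
rewrite (expand_det_row _ 0) !big_ord_recl big_ord0 /cofactor.
rewrite !(expand_det_row _ (0 : 'I_2)) !big_ord_recl !big_ord0 /cofactor.
rewrite !det_mx11 !mxE !aE /= /bump /=.
ring.
Qed.

(** Expansion along the last row leaves [d] times its cofactor, a numerical determinant free of [a],
    [b] and [c]. *)
Lemma det_type4_second (T : 'M[R]_(3, 4)) (a b c d : R) :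
  T = \matrix_(i < 3)
    (\row_k (tangent_coords ([:: a; b; c]`_i) i)`_k : 'rV[R]_4) ->
  \det (col_mx T (d *: delta_mx 0 0) : 'M[R]_4) = 14 * d.
Proof.
move=> ->.
suff detB (B : 'M[R]_4) : (forall i j, B i j =
    (nth [::] [:: tangent_coords a 0; tangent_coords b 1; tangent_coords c 2;
                  [:: d; 0; 0; 0]] i)`_j) ->
    \det B = 14 * d.
  apply: detB => i j; rewrite mxE.
  case: (splitP (i : 'I_(3 + 1))) => k ik; rewrite !mxE ik.
    by case: (ord3P k) => ->.
  rewrite (ord1 k) /=.
  by case: j => [[|[|[|[|//]]]] ?] /=; rewrite ?mulr1 ?mulr0.
move=> BE; rewrite (expand_det_row _ 3) !big_ord_recl big_ord0 !BE /=.
rewrite !mul0r !addr0 /cofactor det_mx33 !mxE !BE /= /bump /=.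
ring.
Qed.

(** Diagonal cofactors suffice: the second form is diagonal, so no others enter the trace. *)
Lemma first_form_type4 a b c (g : 'M[R]_3) :
  (forall i j : 'I_3, g i j =
    iso_dot (\row_k (tangent_coords ([:: a; b; c]`_i) i)`_k : 'rV[R]_4)
            (\row_k (tangent_coords ([:: a; b; c]`_j) j)`_k : 'rV[R]_4)) ->
  [/\ \det g = 49 * (a - b) ^+ 2,
   (\adj g) 0 0 = 37 * b ^+ 2 + 2 * c ^+ 2 - 10 * b * c + 49,
   (\adj g) 1 1 = 37 * a ^+ 2 + 2 * c ^+ 2 - 10 * a * c + 49 &
   (\adj g) 2 2 = 2 * (a - b) ^+ 2].
Proof.
move=> gE.
have {}gE (i j : 'I_3) : g i j = let x := tangent_coords ([:: a; b; c]`_i) i in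
    let y := tangent_coords ([:: a; b; c]`_j) j in
    x`_0 * y`_0 + x`_1 * y`_1 + x`_2 * y`_2.
  rewrite gE /iso_dot big_mkcond !big_ord_recl big_ord0 /= !mxE /= !addr0.
  by rewrite addrA.
split.
- rewrite det_mx33 !gE /=; ring.
all: rewrite mxE /cofactor (expand_det_row _ (0 : 'I_2)) !big_ord_recl big_ord0.
all: rewrite /cofactor !det_mx11 !mxE !gE /= /bump /=.
all: rewrite ?gE /=; ring.
Qed.

(** Here [h_ii] is [14 / (7 |a - b|)] times a second derivative and the inverse of the first form
    brings [49 (a - b)^2] below; with the 3 of [3H] this gives 147. *)
Lemma iso_mean_curvature_type4 (I J K : set R) f g h p :
  open I -> open J -> open K ->
  smooth_on I f -> smooth_on J g -> smooth_on K h -> box I J K p ->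
  derive1 f (p 0 0) - derive1 g (p 0 1) != 0 ->
  let a : R := derive1 f (p 0 0) in
  let b : R := derive1 g (p 0 1) in
  let c : R := derive1 h (p 0 2) in
  147 * `|a - b| ^+ 3 * iso_mean_curvature (type4 f g h) p =
  2 * (weight b c * derive1 (derive1 f) (p 0 0)
       + weight a c * derive1 (derive1 g) (p 0 1)
       + 2 * (a - b) ^+ 2 * derive1 (derive1 h) (p 0 2)).
Proof.
move=> oI oJ oK sf sg sh bp + a b c; rewrite -/a -/b => ab0.
have [Ip [Jp Kp]] := bp.
have pE i : partial i (type4 f g h) p =
    (\row_k (tangent_coords ([:: a; b; c]`_i) i)`_k : 'rV[R]_4).
  rewrite partial_type4; [|exact: (sf 0%N)|exact: (sg 0%N)|exact: (sh 0%N)].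
  by case: (ord3P i) => ->.
pose G := first_form (type4 f g h) p.
have [dE a0 a1 a2] : [/\ \det G = 49 * (a - b) ^+ 2,
   (\adj G) 0 0 = 37 * b ^+ 2 + 2 * c ^+ 2 - 10 * b * c + 49,
   (\adj G) 1 1 = 37 * a ^+ 2 + 2 * c ^+ 2 - 10 * a * c + 49 &
   (\adj G) 2 2 = 2 * (a - b) ^+ 2].
  by apply: first_form_type4 => i j; rewrite mxE !pE.
have uG : G \in unitmx.
  by rewrite unitmxE dE unitfE mulf_neq0// expf_neq0.
have tE : tangent_frame (type4 f g h) p =
   \matrix_(i < 3) (\row_k (tangent_coords ([:: a; b; c]`_i) i)`_k : 'rV[R]_4).
  by apply/row_matrixP => i; rewrite !rowK pE.
have sE i j : second_form (type4 f g h) p i j =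
   2 * ((i == j)%:R * derive1 (derive1 (pick3 f g h i)) (p 0 i)) / `|a - b|.
  rewrite mxE (partial2_type4 _ _ oI oJ oK sf sg sh bp) (det_type4_second _ tE).
  rewrite -/G dE sqrtrM// sqrtr_sqr.
  have -> : Num.sqrt 49 = 7 :> R.
    by rewrite (_ : 49 = 7 ^+ 2)// ?sqrtr_sqr ?ger0_norm//; ring.
  by field; rewrite normr_eq0.
rewrite /iso_mean_curvature -/G /invmx uG -scalemxAr linearZ/= dE.
have diagE i : (second_form (type4 f g h) p *m \adj G) i i
    = 2 * derive1 (derive1 (pick3 f g h i)) (p 0 i) / `|a - b|
      * (\adj G) i i.
  rewrite mxE (bigD1 i)//= big1 ?addr0 ?sE ?eqxx ?mul1r// => j ji.
  by rewrite sE eq_sym (negbTE ji) mul0r mulr0 !mul0r.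
have n0 : `|a - b| != 0 by rewrite normr_eq0.
rewrite /mxtrace !big_ord_recl big_ord0 addr0.
have -> : lift ord0 ord0 = 1 :> 'I_3 by exact: val_inj.
have -> : lift ord0 (lift ord0 ord0) = 2 :> 'I_3 by exact: val_inj.
rewrite !diagE a0 a1 a2 /pick3/= /weight.
(* All powers are expressed through [|a - b|], the one quantity to be inverted. *)
have -> : (a - b) ^+ 2 = `|a - b| ^+ 2 by rewrite real_normK ?num_real.
move: n0; set n := `|a - b|.
set A := derive1 (derive1 f) _; set B := derive1 (derive1 g) _.
set C := derive1 (derive1 h) _.
by clearbody a b c n A B C; clear => n0; field.
Qed.

End Geometry.

(** * Assembly of the cases *)

Theorem theorem6p3 (R : realType) (I J K : set R) (f g h : R -> R)
    (oI : open_interval I) (oJ : open_interval J) (oK : open_interval K)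
    (sf : smooth_on I f) (sg : smooth_on J g) (sh : smooth_on K h)
    (fg : forall u v : R, I u -> J v -> derive1 f u - derive1 g v != 0)
    (Hcst : exists2 H0 : R, H0 != 0 &
       forall p : 'rV[R]_3, box I J K p ->
         iso_mean_curvature (type4 f g h) p = H0) :
  exists lambda mu xi : R,
    (family_i lambda mu xi I J K f g h \/ family_i lambda mu xi J I K g f h) \/
    (family_ii lambda mu xi I J K f g h \/ family_ii lambda mu xi J I K g f h).
Proof.
have [H0 H0neq HE] := Hcst.
have [[oI' iI I0] [oJ' iJ J0] [oK' iK K0]] := And3 oI oJ oK.
have [u v Iu Jv|s s2 fgs] := sign_on iI iJ I0 J0 (sf 1%N) (sg 1%N).
  by rewrite -subr_eq0 fg.
have s0 : s != 0.
  by apply: contra_eq_neq s2 => ->; rewrite expr0n eq_sym oner_eq0.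
pose k := 147 * s * H0 / 2.
have k0 : k != 0 by rewrite !mulf_neq0// invr_neq0.
have E : curvature_eq k I J K f g h.
  move=> u v w Iu Jv Kw.
  pose p : 'rV[R]_3 := \row_i [:: u; v; w]`_i.
  have [p0 p1 p2] : [/\ p 0 0 = u, p 0 1 = v & p 0 2 = w] by rewrite !mxE.
  have bp : box I J K p by rewrite /box/= p0 p1 p2.
  have := iso_mean_curvature_type4 oI' oJ' oK' sf sg sh bp.
  rewrite p0 p1 p2 HE// => /(_ (fg _ _ Iu Jv)) /=; rewrite fgs// => M.
  exact: (curvature_rel_of_mean s2 (fg _ _ Iu Jv) M).
have [hc|hn] := pselect (forall x y, K x -> K y -> derive1 h x = derive1 h y).
  have [w Kw] := K0.
  have hw : derive1 (derive1 h) w = 0.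
    by apply: (derive1_cst_on (c := derive1 h w) oK' Kw) => t Kt; exact: hc.
  have [fc|gc] := not_both_nonconstant k0 iI iJ sf sg Kw E hw.
    have [la [mu [xi F]]] := classification_linear_h k0 s2 oI oJ oK sf sg sh fg
      fgs E hc fc.
    by exists la, mu, xi; right; left.
  (* Interchanging [f] and [g] reverses both [k] and the sign [s]. *)
  have nk0 : - k != 0 by rewrite oppr_eq0.
  have ns2 : (- s) ^+ 2 = 1 by rewrite sqrrN.
  have gf v u : J v -> I u -> derive1 g v - derive1 f u != 0.
    by move=> Jv Iu; rewrite -oppr_eq0 opprB fg.
  have gfs v u : J v -> I u ->
      `|derive1 g v - derive1 f u| = - s * (derive1 g v - derive1 f u).
    by move=> Jv Iu; rewrite distrC fgs// -opprB mulrN mulNr.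
  have [la [mu [xi F]]] := classification_linear_h nk0 ns2 oJ oI oK sg sf sh gf
    gfs (curvature_eq_swap E) hc gc.
  by exists la, mu, xi; right; right.
have [la [mu [xi F]]] :=
  classification_nonlinear_h k0 oI oJ oK sf sg sh fg E hn.
by exists la, mu, xi; left; left.
Qed.
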